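(* Let $F:\mathscr{H}\to 2^{\mathscr{H}}$ be a maximal $\eta_F$-monotone set-valued operator, let $G:\mathscr{H}\to\mathscr{H}$ be $\eta_G$-monotone and $L$-Lipschitz continuous, and let $\gamma>0$ satisfy $$1+\gamma\eta_F>0\quad\text{and}\quad 2(\eta_F+\eta_G)+\gamma\eta_F^2-\gamma L^2>0 .$$ Let $\Phi(z)=z-J_{\gamma F}(z-\gamma G(z))$ and consider the differential equation $$\dot z=-\frac{K_p}{T_p}\,\omega(z)\,\Phi(z),\qquad (\ast)$$ where $\omega(z)=b_1\|\Phi(z)\|^{-(1-p_1)}+b_2\|\Phi(z)\|^{-(1-p_2)}+b_3\|\Phi(z)\|^{-p_3}$ if $\Phi(z)\ne 0$, and $\omega(z)=0$ if $\Phi(z)=0$, with $b_1,b_2,b_3>0$ and $K_p,T_p>0$. Assume that $z^*\in\mathscr{H}$ is the unique equilibrium point of $(\ast)$. Then: (1) For any $p_1\in(0,1)$, $p_2>1$ and $p_3>0$, the point $z^*$, which solves the inclusion problem $0\in F(z)+G(z)$, is a fixed-time stable equilibrium of $(\ast)$. Moreover, there are constants $M_1>0$, $M_2>0$, $r_1\in(0.5,1)$, $r_2>1$ such that for every initial condition $z(0)\in\mathscr{H}$ the settling time satisfies $$T(z(0))\le T_{\max}=\frac{1}{M_1(1-r_1)}+\frac{1}{M_2(r_2-1)}.$$ (2) Furthermore, by choosing $r_1=1-\frac{1}{2\zeta}$ and $r_2=1+\frac{1}{2\zeta}$ with $\zeta>1$, this bound can be refined to $$T(z(0))\le T_{\max}=\frac{\pi\zeta}{\sqrt{M_1M_2}}$$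 for some constants $M_1>0$, $M_2>0$ and $\zeta>1$. (3) When $p_3=0$ (with $p_1\in(0,1)$, $p_2>1$), system $(\ast)$ reaches the equilibrium point within the prescribed time $T_p$, where $T_p>0$ is a user-defined parameter, the control gain $K_p$ being given by $$K_p=\frac{1}{b_3(1-c)(1-p_1)}\ln\!\left(1+\frac{b_3\,2^{\frac{1-p_1}{2}}(1+c)^{1-p_1}}{b_1}\right)+\frac{1}{b_3(1-c)(p_2-1)}\ln\!\left(1+\frac{b_3\,2^{\frac{1-p_2}{2}}(1-c)^{1-p_2}}{b_2}\right),$$ where $c\in(0,1)$ is a Lipschitz constant of the operator $B=J_{\gamma F}\circ(\mathrm{Id}-\gamma G)$.
   Context: $\mathscr{H}$ is a real finite-dimensional Hilbert space with inner product $\langle\cdot,\cdot\rangle$ and norm $\|\cdot\|$; $\mathrm{Id}$ is the identity. A set-valued operator $F:\mathscr{H}\to2^{\mathscr{H}}$ is $\eta_F$-monotone, with $\eta_F\in\mathbb{R}$ (possibly negative), if $\langle z-y,u-w\rangle\ge\eta_F\|z-y\|^2$ for all $z,y\in\mathscr{H}$, $u\in F(z)$, $w\in F(y)$; a single-valued operator $G$ is $\eta_G$-monotone in the same sense. An $\eta_F$-monotone operator is maximal if its graph is not properly contained in the graph of another $\eta_F$-monotone operator. $G$ is $L$-Lipschitz ($L\ge0$) if $\|G(z)-G(w)\|\le L\|z-w\|$ for all $z,w$. The resolvent is $J_{\gamma F}=(\mathrm{Id}+\gamma F)^{-1}$; for maximal $\eta_F$-monotone $F$ and $1+\gamma\eta_F>0$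 it is single-valued and defined on all of $\mathscr{H}$. Under the stated conditions on $\eta_F,\eta_G,L,\gamma$, it is known that there is $c\in(0,1)$ such that $B=J_{\gamma F}\circ(\mathrm{Id}-\gamma G)$ is Lipschitz continuous with constant $c$. For an autonomous differential equation, an equilibrium point is a point where the right-hand side vanishes. An equilibrium $z^*$ is Lyapunov stable if for every $\varepsilon>0$ there is $r>0$ such that any solution with $z(0)\in B(z^*,r)$ (the ball of radius $r$ centred at $z^*$) stays in $B(z^*,\varepsilon)$ for all $t>0$. The settling time $T(z(0))$ is the time after which the trajectory starting at $z(0)$ has reached $z^*$ and remains there. $z^*$ is globally finite-time stable if it is Lyapunov stable and the settling time is finite for all initial conditions in $\mathscr{H}$; (globally) fixed-time stable if moreover the settling time is uniformly bounded over all initial conditions in $\mathscr{H}$; predefined-time stable if it is globally fixed-time stable and the system parameters can be adjusted so that the settling time can be prescribed in advance. *)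

(* Defs.v *)
From HB Require Import structures.
From mathcomp Require Import all_boot all_order all_algebra.
From mathcomp Require Import all_classical all_reals all_analysis.

Set Implicit Arguments.
Unset Strict Implicit.
Unset Printing Implicit Defensive.

Import Order.TTheory GRing.Theory Num.Theory.
Import numFieldNormedType.Exports.

Local Open Scope classical_set_scope.
Local Open Scope ring_scope.

Section Hilbert.
Context {R : realType} {V : normedModType R}.

(* Together these make (V, dot) a finite-dimensional real Hilbert space
   (completeness is automatic); {dot V for idfun} is the type of symmetric
   positive definite bilinear forms on V. *)
Definition norm_from_dot (dot : {dot V for idfun}) : Prop :=
  forall x : V, `|x| = Num.sqrt (dot x x).

Definition finite_dimensional : Prop :=
  exists (n : nat) (e : 'I_n -> V), forall v : V,
    exists a : 'I_n -> R, v = \sum_(i < n) a i *: e i.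

End Hilbert.

Section Operators.
Context {R : realType} {V : normedModType R} (dot : {dot V for idfun}).

Definition eta_monotone (eta : R) (F : V -> set V) : Prop :=
  forall z y u w : V, F z u -> F y w ->
    eta * `|z - y| ^+ 2 <= dot (z - y) (u - w).

Definition maximal_eta_monotone (eta : R) (F : V -> set V) : Prop :=
  eta_monotone eta F /\
  forall F' : V -> set V, eta_monotone eta F' ->
    (forall z, F z `<=` F' z) -> (forall z, F' z `<=` F z).

End Operators.

Section System.
Context {R : realType} {V : normedModType R}.

Definition resolvent_set (gamma : R) (F : V -> set V) (x : V) : set V :=
  [set y | exists2 u, F y u & y + gamma *: u = x].

(* The default value 0 is irrelevant when resolvent_set gamma F x is a
   singleton, which holds for all x when F is maximal eta-monotone and
   1 + gamma * eta > 0. *)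
Definition resolvent (gamma : R) (F : V -> set V) (x : V) : V :=
  xget 0 (resolvent_set gamma F x).

Definition fb_operator (gamma : R) (F : V -> set V) (G : V -> V) (z : V) : V :=
  resolvent gamma F (z - gamma *: G z).

Definition fb_residual (gamma : R) (F : V -> set V) (G : V -> V) (z : V) : V :=
  z - fb_operator gamma F G z.

Definition weight (b1 b2 b3 p1 p2 p3 : R) (w : V) : R :=
  if w == 0 then 0 else
    b1 * `|w| `^ (- (1 - p1)) + b2 * `|w| `^ (- (1 - p2)) + b3 * `|w| `^ (- p3).

Definition vector_field (gamma : R) (F : V -> set V) (G : V -> V)
    (b1 b2 b3 p1 p2 p3 Kp Tp : R) (z : V) : V :=
  let Phi := fb_residual gamma F G in
  - (Kp / Tp * weight b1 b2 b3 p1 p2 p3 (Phi z)) *: Phi z.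

Definition solves_inclusion (F : V -> set V) (G : V -> V) (z : V) : Prop :=
  exists2 u, F z u & u + G z = 0.

End System.

Section AutonomousODE.
Context {R : realType} {V : normedModType R} (f : V -> V).

Definition absolutely_continuous_on (a b : R) (z : R -> V) : Prop :=
  forall eps : R, 0 < eps -> exists2 delta : R, 0 < delta &
    forall (n : nat) (s t : 'I_n -> R),
      (forall i, a <= s i /\ s i <= t i /\ t i <= b) ->
      trivIset setT (fun i => `]s i, t i[%classic) ->
      \sum_(i < n) (t i - s i) < delta ->
      \sum_(i < n) `|z (t i) - z (s i)| < eps.

(* Caratheodory solution on [0, +oo[ of z' = f z: the right-hand side studied
   here may be discontinuous, even unbounded, near its zero, so that a solution
   reaching the zero in finite time need not be differentiable then. *)
Definition solution (z : R -> V) : Prop :=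
  (forall b : R, 0 <= b -> absolutely_continuous_on 0 b z) /\
  {ae lebesgue_measure, forall t : R, 0 < t -> is_derive t 1 z (f (z t))}.

Definition equilibrium (x : V) : Prop := f x = 0.

Definition lyapunov_stable (zs : V) : Prop :=
  equilibrium zs /\
  forall eps : R, 0 < eps -> exists2 r : R, 0 < r &
    forall z : R -> V, solution z -> ball zs r (z 0) ->
      forall t : R, 0 < t -> ball zs eps (z t).

(* Equal to +oo if no finite time works; if z0 is the initial value of several
   solutions, the time has to be valid for all of them. *)
Definition settling_time (zs z0 : V) : \bar R :=
  ereal_inf [set T%:E | T in [set T : R | 0 <= T /\
    forall z : R -> V, solution z -> z 0 = z0 ->
      forall t : R, T <= t -> z t = zs]].

Definition globally_finite_time_stable (zs : V) : Prop :=
  lyapunov_stable zs /\ forall z0 : V, (settling_time zs z0 < +oo)%E.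

Definition fixed_time_stable (zs : V) : Prop :=
  globally_finite_time_stable zs /\
  exists Tmax : R, forall z0 : V, (settling_time zs z0 <= Tmax%:E)%E.

End AutonomousODE.

Definition fixed_time_bound {R : realType} (M1 M2 r1 r2 : R) : R :=
  1 / (M1 * (1 - r1)) + 1 / (M2 * (r2 - 1)).

Definition refined_bound {R : realType} (M1 M2 zeta : R) : R :=
  pi * zeta / Num.sqrt (M1 * M2).

Definition predefined_gain {R : realType} (b1 b2 b3 p1 p2 c : R) : R :=
  1 / (b3 * (1 - c) * (1 - p1)) *
    ln (1 + b3 * 2 `^ ((1 - p1) / 2) * (1 + c) `^ (1 - p1) / b1) +
  1 / (b3 * (1 - c) * (p2 - 1)) *
    ln (1 + b3 * 2 `^ ((1 - p2) / 2) * (1 - c) `^ (1 - p2) / b2).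

(* Main.v *)
Require Import Defs.
From mathcomp Require Import all_boot all_order all_algebra.
From mathcomp Require Import all_classical all_reals all_analysis.
From mathcomp Require Import measurable_realfun.
From mathcomp Require Import ring lra.
Import Order.TTheory GRing.Theory Num.Theory.
Import numFieldNormedType.Exports.
Local Open Scope classical_set_scope.
Local Open Scope ring_scope.
Set Implicit Arguments.
Unset Strict Implicit.
Unset Printing Implicit Defensive.

(** The resolvent of a maximal [eta]-monotone operator is everywhere defined
([minty], obtained from the one-point extension [kirszbraun_point] of nonexpansive
maps) and Lipschitz with constant [1 / (1 + gamma eta)]; composed with the forward
step it gives a contraction of some constant [c < 1] ([fb_operator_contraction]).
Hence the residual [Phi], the identity minus a contraction, is comparable with the
distance to its zero [zs] and satisfies
[<z - zs, Phi z> >= (1 - c) |z - zs|^2]; and a zero of [Phi] solves the inclusion.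

Along a trajectory, the distance [phi = |z - zs|] therefore satisfies almost
everywhere [phi' <= - (beta1 phi^p1 + beta2 phi^p2 + b phi)] ([distance_decay]).
Solutions are absolutely continuous and differentiable only almost everywhere, so
the passage from this inequality to finite differences rests on
[ae_derivative_growth]: an absolutely continuous function whose derivative is
almost everywhere at most [k] grows at most at speed [k].

The scalar inequality is then integrated in two phases ([decay_settles]). Above a
threshold [theta] the superlinear power brings [phi] down to [theta] in a time that
does not depend on the initial value, because [1 / (beta2 v^p2 + b v)] is integrable
at infinity; below it the sublinear power brings [phi] to 0 in finite time, because
[1 / (beta1 v^p1 + b v)] is integrable at 0. Both integrals are logarithms
([decay_clock]). For [p3 = 0] the linear term is the third term of the weight, and
[theta = sqrt 2] turns the sum of the two integrals into exactly [Tp] for the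
prescribed gain. For [p3 > 0] the singular third term only helps; it is replaced by
a linear term taken from the two powers, which gives a settling time [T] valid for
all initial values, and the constants of the closed-form bounds are adjusted to [T].
Stability holds because [phi] is nonincreasing. *)

(** * Inner products in finite dimension *)

Section InnerProduct.
Context {R : realType} {V : normedModType R} (dot : {dot V for idfun}).
Implicit Types (x y z : V) (a : R).

Lemma dotC x y : dot x y = dot y x.
Proof. by rewrite (hermitian_subproof x y) expr0 mul1r. Qed.

Lemma dotDl x y z : dot (x + y) z = dot x z + dot y z.
Proof. exact: linearDl. Qed.

Lemma dotNl x z : dot (- x) z = - dot x z.
Proof. exact: linearNl. Qed.

Lemma dotZl a x z : dot (a *: x) z = a * dot x z.
Proof. exact: linearZl_LR. Qed.

Lemma dotDr x y z : dot z (x + y) = dot z x + dot z y.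
Proof. by rewrite dotC dotDl !(dotC z). Qed.

Lemma dotNr x z : dot z (- x) = - dot z x.
Proof. by rewrite dotC dotNl (dotC z). Qed.

Lemma dotZr a x z : dot z (a *: x) = a * dot z x.
Proof. by rewrite dotC dotZl (dotC z). Qed.

Lemma dot0l z : dot 0 z = 0.
Proof. by rewrite -(scale0r 0) dotZl mul0r. Qed.

Lemma dot0r z : dot z 0 = 0.
Proof. by rewrite dotC dot0l. Qed.

Lemma dot_suml (I : Type) (r : seq I) (E : I -> V) z :
  dot (\sum_(i <- r) E i) z = \sum_(i <- r) dot (E i) z.
Proof.
exact: (big_morph (fun x => dot x z) (fun x y => dotDl x y z) (dot0l z)).
Qed.

Definition dotE :=
  (dotDl, dotDr, dotNl, dotNr, dotZl, dotZr, dot0l, dot0r).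

Lemma dot_ge0 x : 0 <= dot x x.
Proof.
have [->|x0] := eqVneq x 0; first by rewrite dot0l.
exact/ltW/neq0_dnorm_gt0.
Qed.

Hypothesis hdot : norm_from_dot dot.

Lemma norm_sqr x : `|x| ^+ 2 = dot x x.
Proof. by rewrite hdot sqr_sqrtr// dot_ge0. Qed.

Lemma norm_le_dot x y : (`|x| <= `|y|) = (dot x x <= dot y y).
Proof. by rewrite -!norm_sqr ler_pXn2r ?nnegrE. Qed.

Lemma cauchy_schwarz x y : `|dot x y| <= `|x| * `|y|.
Proof.
rewrite -(@ler_pXn2r _ 2%N) ?nnegrE ?mulr_ge0// real_normK ?num_real//.
rewrite exprMn !norm_sqr.
have [->|x0] := eqVneq x 0; first by rewrite !dot0l expr0n mul0r.
have xx : 0 < dot x x by exact: neq0_dnorm_gt0.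
have := dot_ge0 (dot x x *: y - dot x y *: x).
rewrite !dotE (dotC y x) => h.
have : 0 <= dot x x * (dot x x * dot y y - dot x y ^+ 2).
  apply: le_trans h _; rewrite le_eqVlt; apply/orP; left; apply/eqP; ring.
by rewrite pmulr_rge0// subr_ge0.
Qed.

Lemma dot_le x y : dot x y <= `|x| * `|y|.
Proof. exact: le_trans (ler_norm _) (cauchy_schwarz _ _). Qed.

(** The vectors of [g] come out orthonormal, so that the Fourier expansion along [g]
reproduces every combination of them; the induction over [s] normalises the
component of the new vector orthogonal to the previous ones, when it is nonzero. *)
Lemma gram_schmidt (s : seq V) : exists g : seq V,
  forall x, x \in s -> x = \sum_(h <- g) dot x h *: h.
Proof.
suff [g [_ gP]] : exists g : seq V,
    (forall h, h \in g -> forall x, dot (\sum_(k <- g) dot x k *: k) h = dot x h)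
    /\ forall x, x \in s -> x = \sum_(h <- g) dot x h *: h by exists g.
elim: s => [|x s [g [gO gP]]]; first by exists [::].
pose r := x - \sum_(h <- g) dot x h *: h.
have rO h : h \in g -> dot r h = 0.
  by move=> hg; rewrite /r dotDl dotNl gO// subrr.
have [r0|r0] := eqVneq r 0.
  exists g; split => // y; rewrite inE => /predU1P[->|/gP//].
  by apply/eqP; rewrite -subr_eq0; apply/eqP.
pose e := `|r|^-1 *: r.
have nr : `|r| != 0 by rewrite normr_eq0.
have ee : dot e e = 1.
  by rewrite /e dotZl dotZr -norm_sqr expr2 mulKf// mulVf.
have eO h : h \in g -> dot e h = 0 by move=> hg; rewrite /e dotZl rO// mulr0.
have sumO y : dot (\sum_(h <- g) dot y h *: h) e = 0.
  rewrite dot_suml big1_seq// => h /andP[_ hg].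
  by rewrite dotZl (dotC h) eO// mulr0.
exists (e :: g); split.
  move=> h; rewrite inE => /predU1P[->|hg] y; rewrite big_cons dotDl dotZl.
    by rewrite ee mulr1 sumO addr0.
  by rewrite eO// mulr0 add0r gO.
have xe : dot x e *: e = r.
  have -> : x = r + \sum_(h <- g) dot x h *: h by rewrite /r subrK.
  rewrite dotDl sumO addr0 /e dotZr -norm_sqr scalerA.
  by rewrite expr2 mulKf// mulfV// scale1r.
move=> y; rewrite inE big_cons => /predU1P[->|ys].
  by rewrite xe /r subrK.
by rewrite [in dot y e](gP y ys) sumO scale0r add0r; exact: gP.
Qed.

Lemma finite_dim_basis : @finite_dimensional R V ->
  exists g : seq V, forall x, x = \sum_(h <- g) dot x h *: h.
Proof.
move=> [n [e eP]].
have [g gP] := gram_schmidt [seq e i | i <- enum 'I_n].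
exists g => x; have [a ->] := eP x.
have ge i : e i = \sum_(h <- g) dot (e i) h *: h.
  by apply: gP; apply: map_f; rewrite mem_enum.
under [LHS]eq_bigr do rewrite ge scaler_sumr.
rewrite exchange_big/=; apply: eq_bigr => h _.
rewrite dot_suml scaler_suml; apply: eq_bigr => i _.
by rewrite dotZl scalerA.
Qed.

(** Coordinatewise completeness: the scalar products of a Cauchy sequence with a
fixed vector form a Cauchy sequence of reals, by the Cauchy-Schwarz inequality. *)
Lemma finite_dim_complete : @finite_dimensional R V ->
  forall u : nat -> V,
  (forall e : R, 0 < e -> exists N, forall n m, (N <= n)%N -> (N <= m)%N ->
    `|u n - u m| < e) ->
  exists l : V, u @ \oo --> l.
Proof.
move=> /finite_dim_basis[g gP] u uC.
have cv h : exists l : R, (fun n => dot (u n) h) @ \oo --> l.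
  have hp : 0 < `|h| + 1 by rewrite ltr_wpDl.
  apply/cvg_ex; apply/cauchy_cvgP/cauchy_exP => e e0.
  have [N NP] := uC (e / (`|h| + 1)) (divr_gt0 e0 hp).
  exists (dot (u N) h); exists N => // n /= Nn.
  rewrite /ball/= -dotNl -dotDl; apply: le_lt_trans (cauchy_schwarz _ _) _.
  have := NP N n (leqnn _) Nn; rewrite ltr_pdivlMr//; apply: le_lt_trans.
  by rewrite ler_wpM2l// lerDl.
have [l lP] := choice cv.
exists (\sum_(h <- g) l h *: h).
rewrite (_ : u = fun n => \sum_(h <- g) dot (u n) h *: h); last first.
  by apply/funext => n; exact: gP.
apply: cvg_big => [|h _]; first exact: add_continuous.
apply: cvgZr_tmp.
exact: lP.
Qed.

End InnerProduct.

(** * Maximal monotone operators have full resolvents *)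

Section Kirszbraun.
Context {R : realType} {V : normedModType R} (dot : {dot V for idfun}).
Hypothesis hdot : norm_from_dot dot.

(** The convex hull, in [V * V * R], of the points [(m, n, |m|^2 - |n|^2)] for [(m, n)]
in the relation [A]. Convex combinations are written [x + t (x' - x)] so that
quadratic expressions in them expand in powers of [t]. *)
Inductive hull (A : V -> V -> Prop) : V -> V -> R -> Prop :=
| hull_base m n : A m n -> hull A m n (dot m m - dot n n)
| hull_mix t m n c m' n' c' : 0 <= t <= 1 ->
    hull A m n c -> hull A m' n' c' ->
    hull A (m + t *: (m' - m)) (n + t *: (n' - n)) (c + t * (c' - c)).

(** On the generating points this is the inequality [|m - m'|^2 <= |n - n'|^2]
expanded; both sides are affine in each of the two points, so it extends to the
hull by a double induction. *)
Lemma hull_pairing (A : V -> V -> Prop) :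
  (forall m n m' n', A m n -> A m' n' -> `|m - m'| <= `|n - n'|) ->
  forall m n c m' n' c', hull A m n c -> hull A m' n' c' ->
  c + c' <= 2 * dot m m' - 2 * dot n n'.
Proof.
move=> hA m n c m' n' c' h; move: h m' n' c'.
elim=> {m n c} [m n mn m' n' c'|t m n c p q d /andP[t0 t1] _ IH1 _ IH2 m' n' c' h].
  elim=> {m' n' c'} [m' n' /(hA _ _ _ _ mn)|t m1 n1 c1 p q d /andP[t0 t1] _ IH1 _ IH2].
    rewrite (norm_le_dot hdot) !dotE (dotC dot m' m) (dotC dot n' n); lra.
  rewrite !dotE.
  have : (1 - t) * (dot m m - dot n n + c1) <= (1 - t) * (2 * dot m m1 - 2 * dot n n1).
    by rewrite ler_wpM2l// subr_ge0.
  have : t * (dot m m - dot n n + d) <= t * (2 * dot m p - 2 * dot n q).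
    by rewrite ler_wpM2l.
  lra.
rewrite !dotE.
have : (1 - t) * (c + c') <= (1 - t) * (2 * dot m m' - 2 * dot n n').
  by rewrite ler_wpM2l ?IH1// subr_ge0.
have : t * (d + c') <= t * (2 * dot p m' - 2 * dot q n').
  by rewrite ler_wpM2l ?IH2.
lra.
Qed.

(** The diagonal case of the pairing gives [c <= |m|^2 - |n|^2] on the hull. *)
Lemma hull_le (A : V -> V -> Prop) :
  (forall m n m' n', A m n -> A m' n' -> `|m - m'| <= `|n - n'|) ->
  forall m n c, hull A m n c -> 0 <= dot m m - c.
Proof.
move=> hA m n c h; have := hull_pairing hA h h.
have := dot_ge0 dot n; lra.
Qed.

(** One-point extension in Kirszbraun's theorem: a nonexpansive correspondence
[n |-> m] can be extended to the point 0, i.e. the balls centred at [m] of radius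
[|n|] have a common point.

The common point is found by a dual problem. Finding [y] with
[|y|^2 - 2 <y, m> + |m|^2 - |n|^2 <= 0] for all [(m, n)] amounts to making a
maximum of functions with the same quadratic part nonpositive; its Lagrangian dual
is the minimisation of [|m|^2 - c >= 0] over the hull. The objective is uniformly
convex in [m], hence a minimising sequence is Cauchy in [m]; its limit is [y],
and the first-order optimality condition towards a generator [(m, n)] is
the wanted inequality at that generator. Working with a minimising sequence avoids
any compactness of the hull, which may be infinitely generated. *)
Lemma kirszbraun_point (hdim : @finite_dimensional R V) (A : V -> V -> Prop) :
  (forall m n m' n', A m n -> A m' n' -> `|m - m'| <= `|n - n'|) ->
  exists y, forall m n, A m n -> `|y - m| <= `|n|.
Proof.
move=> hA.
have [[m0 [n0 A0]]|noA] := pselect (exists m n, A m n); last first.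
  by exists 0 => m n mn; case: noA; exists m, n.
pose S : set R := [set v | exists m n c, hull A m n c /\ v = dot m m - c].
have S0 : S !=set0.
  by exists (dot m0 m0 - (dot m0 m0 - dot n0 n0)), m0, n0, (dot m0 m0 - dot n0 n0); split=> //; exact: hull_base.
have Slb : lbound S 0 by move=> _ [m [n [c [h ->]]]]; exact: hull_le h.
have infS : has_inf S by split=> //; exists 0.
pose d := inf S.
have dle m n c : hull A m n c -> d <= dot m m - c.
  by move=> h; apply: ge_inf; [exists 0|exists m, n, c].
have d0 : 0 <= d by exact: lb_le_inf.
have approx k : exists m, exists n c, hull A m n c /\ dot m m - c < d + k.+1%:R^-1.
  have kp : 0 < (k.+1%:R : R)^-1 by rewrite invr_gt0.
  have [_ [m [n [c [h ->]]]] lt] := inf_adherent kp infS.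
  by exists m, n, c.
have [u uP] := choice approx.
have [y uy] : exists y : V, u @ \oo --> y.
  apply: (finite_dim_complete hdot hdim) => e e0.
  have e20 : 0 < e ^+ 2 / 4 by rewrite divr_gt0// exprn_gt0.
  have [N _ NP] := near_infty_natSinv_lt (PosNum e20).
  exists N => i j Ni Nj.
  have [n [c [hi li]]] := uP i; have [n' [c' [hj lj]]] := uP j.
  (* The midpoint of two almost minimisers cannot beat the infimum, so the
     parallelogram identity bounds their distance. *)
  have t12 : 0 <= (2^-1 : R) <= 1 by apply/andP; split; lra.
  have := dle _ _ _ (hull_mix t12 hi hj).
  have h2 : dot (u i) (u i) - c < d + e ^+ 2 / 4.
    by apply: lt_trans li _; rewrite ltrD2l; exact: NP.
  have h3 : dot (u j) (u j) - c' < d + e ^+ 2 / 4.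
    by apply: lt_trans lj _; rewrite ltrD2l; exact: NP.
  rewrite !dotE (dotC dot (u j) (u i)) => h1.
  suff : `|u i - u j| ^+ 2 < e ^+ 2.
    by rewrite ltr_pXn2r ?nnegrE ?(ltW e0).
  rewrite (norm_sqr hdot).
  by rewrite !dotE (dotC dot (u j) (u i)); lra.
exists y => m n mn; rewrite -(@ler_pXn2r _ 2%N) ?nnegrE//.
(* Moving the almost minimiser [u k] by a fraction [t] towards [m] does not go
   below the infimum; the inequality is divided by [t] after [k] is so large that
   the defect of [u k] is at most [t * e]. *)
have key (t : R) : 0 < t < 1 -> (1 - t) * `|y - m| ^+ 2 <= `|n| ^+ 2.
  move=> /andP[t0 t1].
  apply/ler_addgt0Pr => e e0.
  have te : 0 < t * e by exact: mulr_gt0.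
  have [N _ NP] := near_infty_natSinv_lt (PosNum te).
  have um : (fun k => `|u k - m|) @ \oo --> `|y - m|.
    by apply: cvg_norm; apply: cvgB => //; exact: cvg_cst.
  have um2 := cvgM (cvg_cst (1 - t)) (cvgM um um).
  rewrite expr2; apply: (cvgr_to_le (um2 _ _ _)).
  exists N => // k Nk /=; rewrite -expr2.
  have [n' [c [h l]]] := uP k.
  have t01 : 0 <= t <= 1 by rewrite !ltW.
  have h1 := dle _ _ _ (hull_mix t01 h (hull_base mn)).
  have h3 : dot (u k) (u k) - c < d + t * e.
    by apply: lt_trans l _; rewrite ltrD2l; exact: NP.
  rewrite !(norm_sqr hdot).
  rewrite -(ler_pM2l t0).
  move: h1; rewrite !dotE (dotC dot m (u k)).
  nra.
rewrite leNgt; apply/negP => lt.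
have a0 : 0 < `|y - m| ^+ 2 by apply: le_lt_trans lt; rewrite exprn_ge0.
have b0 : 0 <= `|n| ^+ 2 by rewrite exprn_ge0.
(* With this [t] the left-hand side of [key] is the mean of both squares. *)
pose t := (`|y - m| ^+ 2 - `|n| ^+ 2) / (2 * `|y - m| ^+ 2).
have t01 : 0 < t < 1.
  have a20 : 0 < 2 * `|y - m| ^+ 2 by rewrite mulr_gt0.
  apply/andP; split; first by rewrite /t divr_gt0// subr_gt0.
  by rewrite /t ltr_pdivrMr//; lra.
have := key t t01; rewrite mulrBl mul1r.
have -> : t * `|y - m| ^+ 2 = (`|y - m| ^+ 2 - `|n| ^+ 2) / 2.
  by rewrite /t; field; move: a0; apply: contraTneq => ->; rewrite expr0n ltxx.
lra.
Qed.

(** Minty's theorem for [eta]-monotone operators. The Cayley transform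
[n = (z + gamma u - x) / (2 k)], [m = z - n], with [k = 1 + gamma eta], turns
[eta]-monotonicity of the graph of [F] into nonexpansiveness of [n |-> m]. If [y]
is the extension at [n = 0], then the pair [(y, (x - y) / gamma)] is
[eta]-monotonically related to the graph, hence belongs to it by maximality,
which says that [y] is a resolvent point of [x]. *)
Lemma minty (hdim : @finite_dimensional R V) (F : V -> set V) (eta gamma : R) (x : V) :
  maximal_eta_monotone dot eta F -> 0 < gamma -> 0 < 1 + gamma * eta ->
  resolvent_set gamma F x !=set0.
Proof.
move=> [mon maxF] g0 k0; set k := 1 + gamma * eta in k0.
pose n z u := (2 * k)^-1 *: (z + gamma *: u - x).
pose A m n' := exists z u, [/\ F z u, n' = n z u & m = z - n z u].
have hA m n1 m' n1' : A m n1 -> A m' n1' -> `|m - m'| <= `|n1 - n1'|.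
  move=> [z [u [Fzu -> ->]]] [z' [u' [Fzu' -> ->]]].
  have := mon _ _ _ _ Fzu Fzu'.
  rewrite (norm_sqr hdot) (norm_le_dot hdot).
  have dn : n z u - n z' u' = (2 * k)^-1 *: ((z - z') + gamma *: (u - u')).
    rewrite /n -scalerBr; congr (_ *: _).
    by rewrite scalerBr opprB addrA subrK opprD addrACA.
  rewrite dn.
  have -> : z - n z u - (z' - n z' u') = (z - z') - (2 * k)^-1 *: ((z - z') + gamma *: (u - u')).
    rewrite -dn !opprB [n z' u' - z']addrC addrACA [- n z u + _]addrC.
    by [].
  move: (z - z') (u - u') => a b hab.
  suff : dot a a <= 2 * ((2 * k)^-1 * (dot a a + gamma * dot a b)).
    by rewrite !dotE (dotC dot b a); lra.
  rewrite invfM mulrA mulVKf// ler_pdivlMl//.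
  have := ler_wpM2l (ltW g0) hab; rewrite /k; lra.
have [y yP] := kirszbraun_point hdim hA.
pose u0 := gamma^-1 *: (x - y).
exists y; exists u0; last by rewrite /u0 scalerA mulfV ?gt_eqF// scale1r addrC subrK.
pose F' z := F z `|` [set u | z = y /\ u = u0].
have key z u : F z u -> eta * `|z - y| ^+ 2 <= dot (z - y) (u - u0).
  move=> Fzu.
  have := yP (z - n z u) (n z u); rewrite (norm_le_dot hdot).
  have -> : y - (z - n z u) = n z u - (z - y).
    by rewrite !opprB addrCA addrA addrC.
  move=> /(_ (ex_intro _ z (ex_intro _ u (And3 Fzu erefl erefl)))) h.
  have nE : dot (z - y) (n z u) = (2 * k)^-1 * dot (z - y) (z + gamma *: u - x).
    by rewrite dotZr.
  have h1 : dot (z - y) (z - y) <= 2 * dot (z - y) (n z u).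
    by move: h; move: (z - y) (n z u) => a w; rewrite !dotE (dotC dot w a); lra.
  have uE : gamma *: (u - u0) = (z + gamma *: u - x) - (z - y).
    rewrite scalerBr /u0 scalerA mulfV ?gt_eqF// scale1r.
    rewrite -[z + _ - x]addrA [z + (_ - x)]addrC [- (z - y)]opprB [y - z]addrC addrA addrK.
    by rewrite opprB [y - x]addrC addrA.
  have h2 : gamma * dot (z - y) (u - u0) = dot (z - y) (z + gamma *: u - x) - dot (z - y) (z - y).
    by rewrite -dotZr uE dotDr dotNr.
  rewrite (norm_sqr hdot) -(ler_pM2l g0) h2.
  move: h1; rewrite nE invfM mulrA mulVKf// ler_pdivlMl// /k; lra.
apply: (maxF F'); last by right.
- move=> z1 z2 u1 u2 [F1|[-> ->]] [F2|[-> ->]].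
  + exact: mon.
  + exact: key.
  + rewrite -opprB normrN -[u0 - _]opprB dotNl dotNr opprK; exact: key.
  + by rewrite !subrr normr0 expr0n mulr0 dot0l.
- by move=> z u; left.
Qed.
End Kirszbraun.

(** * The forward-backward operator is a contraction *)

Section Contraction.
Context {R : realType} {V : normedModType R} (dot : {dot V for idfun}).
Hypothesis hdot : norm_from_dot dot.

Lemma resolvent_set_expansion (F : V -> set V) (eta gamma : R) x x' y y' :
  eta_monotone dot eta F -> 0 < gamma ->
  resolvent_set gamma F x y -> resolvent_set gamma F x' y' ->
  (1 + gamma * eta) * `|y - y'| <= `|x - x'|.
Proof.
move=> mon g0 [u Fu <-] [u' Fu' <-].
have [->|yy] := eqVneq (y - y') 0; first by rewrite normr0 mulr0.
rewrite -(ler_pM2r (_ : 0 < `|y - y'|)) ?normr_gt0//.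
have -> : y + gamma *: u - (y' + gamma *: u') = (y - y') + gamma *: (u - u').
  by rewrite scalerBr opprD addrACA.
rewrite [leRHS]mulrC; apply: le_trans (dot_le hdot _ _).
rewrite -mulrA -expr2.
have := ler_wpM2l (ltW g0) (mon _ _ _ _ Fu Fu').
rewrite (norm_sqr hdot); move: (y - y') (u - u') => a b.
by rewrite dotDr dotZr; lra.
Qed.

Lemma forward_step_bound (G : V -> V) (eta L gamma : R) z y :
  eta_monotone dot eta (fun z => [set G z]) -> 0 < gamma -> 0 <= L ->
  L.-lipschitz G ->
  `|(z - gamma *: G z) - (y - gamma *: G y)| ^+ 2
    <= (1 - 2 * gamma * eta + gamma ^+ 2 * L ^+ 2) * `|z - y| ^+ 2.
Proof.
move=> mon g0 L0 lip.
have -> : (z - gamma *: G z) - (y - gamma *: G y) = (z - y) - gamma *: (G z - G y).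
  by rewrite scalerBr !opprB [_ *: G y - y]addrC addrACA [- (_ *: _) + _]addrC.
have h1 : eta * `|z - y| ^+ 2 <= dot (z - y) (G z - G y) by exact: mon.
have : `|G z - G y| <= L * `|z - y| by exact: (lip (z, y)).
rewrite -(@ler_pXn2r _ 2%N) ?nnegrE ?mulr_ge0// exprMn.
move: (z - y) (G z - G y) h1 => a b h1 h2.
rewrite (norm_sqr hdot) !dotE (dotC dot b a) -!(norm_sqr hdot).
have := ler_wpM2l (ltW g0) h1.
have := ler_wpM2l (sqr_ge0 gamma) h2.
lra.
Qed.

(** Composing both estimates, the square of the Lipschitz constant is at most
[(1 - 2 gamma etaG + gamma^2 L^2) / (1 + gamma etaF)^2], and the difference
between denominator and numerator is [gamma] times the quantity assumed
positive. The numerator may be negative in the zero space and may vanish when the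
forward step is constant, hence the two maxima. *)
Lemma fb_operator_contraction (hdim : @finite_dimensional R V)
    (F : V -> set V) (G : V -> V) (etaF etaG L gamma : R) :
  maximal_eta_monotone dot etaF F ->
  eta_monotone dot etaG (fun z => [set G z]) ->
  0 <= L -> L.-lipschitz G -> 0 < gamma -> 0 < 1 + gamma * etaF ->
  0 < 2 * (etaF + etaG) + gamma * etaF ^+ 2 - gamma * L ^+ 2 ->
  exists2 c : R, 0 < c < 1 & c.-lipschitz (fb_operator gamma F G).
Proof.
move=> hF hG L0 hL g0 k0 hpar.
set k := 1 + gamma * etaF in k0.
pose q := Num.max 0 (1 - 2 * gamma * etaG + gamma ^+ 2 * L ^+ 2).
have q0 : 0 <= q by rewrite le_max lexx.
have qk : q < k ^+ 2.
  rewrite gt_max exprn_gt0//= /k.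
  have := mulr_gt0 g0 hpar; lra.
pose c := Num.max (Num.sqrt q / k) 2^-1.
have c0 : 0 < c by rewrite lt_max invr_gt0 ltr0n orbT.
exists c.
  rewrite c0/= gt_max ltr_pdivrMr// mul1r; apply/andP; split; last lra.
  by rewrite -(ger0_norm (ltW k0)) -sqrtr_sqr ltr_sqrt// exprn_gt0.
move=> [z y] _ /=.
have res x : resolvent_set gamma F x (resolvent gamma F x).
  by apply: xgetPex; exact: (minty hdot hdim _ hF).
have := resolvent_set_expansion (proj1 hF) g0 (res (z - gamma *: G z)) (res (y - gamma *: G y)).
rewrite -/(fb_operator gamma F G z) -/(fb_operator gamma F G y) -/k => h1.
have h2 : `|(z - gamma *: G z) - (y - gamma *: G y)| <= Num.sqrt q * `|z - y|.
  rewrite -(@ler_pXn2r _ 2%N) ?nnegrE ?mulr_ge0 ?sqrtr_ge0// exprMn sqr_sqrtr//.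
  apply: le_trans (forward_step_bound _ _ hG g0 L0 hL) _.
  by rewrite ler_wpM2r ?exprn_ge0// le_max lexx orbT.
rewrite -(ler_pM2l k0); apply: le_trans h1 (le_trans h2 _).
rewrite mulrA ler_wpM2r// -ler_pdivrMl// mulrC le_max lexx//.
Qed.

(** Minty's theorem enters here: the default value 0 of the resolvent is excluded
because the resolvent set is inhabited. *)
Lemma fixed_point_solves_inclusion (hdim : @finite_dimensional R V)
    (F : V -> set V) (G : V -> V) (etaF gamma : R) z :
  maximal_eta_monotone dot etaF F -> 0 < gamma -> 0 < 1 + gamma * etaF ->
  fb_residual gamma F G z = 0 -> solves_inclusion F G z.
Proof.
move=> hF g0 k0 /eqP; rewrite subr_eq0 => /eqP zE.
have : resolvent_set gamma F (z - gamma *: G z) (fb_operator gamma F G z).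
  by apply: xgetPex; exact: (minty hdot hdim _ hF).
rewrite -zE => -[u Fu /addrI h]; exists u => //.
have : gamma *: (u + G z) = 0 by rewrite scalerDr h addNr.
by move/eqP; rewrite scaler_eq0 gt_eqF//= => /eqP.
Qed.

End Contraction.

(** * Growth of absolutely continuous functions *)

Section Growth.
Context {R : realType}.
Implicit Types (a b x : R) (U : set R) (l : seq (R * R)).
Local Notation mu := (@lebesgue_measure R).

(** The induction principle on a real interval that replaces Cousin's lemma on fine
tagged partitions: it is enough to be able to step across every point, with a
step size depending on the point. *)
Lemma real_induction (a b : R) (P : R -> Prop) : a <= b -> P a ->
  (forall c, a <= c <= b -> exists2 r : R, 0 < r &
    forall s s', a <= s -> s <= c -> c <= s' -> s' <= b ->
      c - r < s -> s' < c + r -> P s -> P s') ->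
  P b.
Proof.
move=> ab Pa step.
pose X : set R := [set x | a <= x <= b /\ P x].
have Xa : X a by split; rewrite // lexx.
have ubX : ubound X b by move=> x [/andP[_ ?] _].
have lubX : has_ubound X by exists b.
have supX : has_sup X by split => //; exists a.
pose c := sup X.
have ac : a <= c by exact: (ub_le_sup lubX).
have cb : c <= b by apply: ge_sup => //; exists a.
have [r r0 rP] := step c (introT andP (conj ac cb)).
have [s [/andP[as_ sb] Ps] cs] := sup_adherent r0 supX.
have sc : s <= c by apply: (ub_le_sup lubX); split; rewrite // as_.
have [bc|cb'] := leP b c.
  have <- : c = b by apply/eqP; rewrite eq_le cb bc.
  by apply: (rP s c) => //; rewrite ltrDl.
pose s' := Num.min b (c + r / 2).
have s'b : s' <= b by rewrite ge_min lexx.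
have cs' : c < s' by rewrite lt_min cb' ltrDl divr_gt0.
have s'c : s' < c + r.
  by rewrite /s' gt_min ltrD2l; apply/orP; right; lra.
have Ps' : P s' by apply: (rP s s') => //; exact: ltW.
have : X s' by split=> //; rewrite s'b andbT (le_trans ac)// ltW.
move=> /(ub_le_sup lubX); by rewrite leNgt -/c cs'.
Qed.

(** Disjoint intervals of [U] between [a] and [x], listed from right to left. *)
Fixpoint chain U a x l : Prop :=
  if l is p :: l' then
    [/\ p.1 <= p.2, p.2 <= x, `]p.1, p.2[ `<=` U & chain U a p.1 l']
  else a <= x.

Lemma chain_le U a x l : chain U a x l -> a <= x.
Proof.
elim: l x => [//|p l IH] x /= [p12 px _ /IH ap].
exact: le_trans ap (le_trans p12 px).
Qed.

Lemma chain_mono U a x y l : x <= y -> chain U a x l -> chain U a y l.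
Proof.
move=> xy; case: l => [|p l] /=; first by move=> ax; exact: le_trans xy.
by move=> [? px ? ?]; split=> //; exact: le_trans xy.
Qed.

Lemma chain_nth U a x l i : chain U a x l -> (i < size l)%N ->
  [/\ a <= (nth (0, 0) l i).1, (nth (0, 0) l i).1 <= (nth (0, 0) l i).2 &
      (nth (0, 0) l i).2 <= x].
Proof.
elim: l x i => [//|p l IH] x [|i] /= [p12 px _ ch] il.
  by split=> //; exact: chain_le ch.
have [h1 h2 h3] := IH _ _ ch il; split=> //.
exact: le_trans h3 (le_trans p12 px).
Qed.

Lemma chain_nth_le U a x l i j : chain U a x l -> (i < j < size l)%N ->
  (nth (0, 0) l j).2 <= (nth (0, 0) l i).1.
Proof.
elim: l x i j => [|p l IH] x [|i] [|j] //=; rewrite ?andbF//.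
- by move=> [_ _ _ ch] jl; have [] := chain_nth ch jl.
- by move=> [_ _ _ ch] jl; exact: IH ch jl.
Qed.

Lemma chain_measure U a x l : open U -> chain U a x l ->
  ((\sum_(p <- l) (p.2 - p.1))%:E <= mu (U `&` `]a, x[%classic))%E.
Proof.
move=> oU; elim: l x => [|p l IH] x /=; first by rewrite big_nil.
move=> [p12 px pU ch]; rewrite big_cons EFinD addeC.
have mI (u v : R) : measurable (U `&` `]u, v[%classic).
  by apply: measurableI; [exact: open_measurable|exact: measurable_itv].
apply: le_trans (leeD (IH _ ch) (lexx _)) _.
rewrite (_ : (p.2 - p.1)%:E = mu `]p.1, p.2[%classic); last first.
  rewrite lebesgue_measure_itv/= lte_fin; case: ltgtP p12 => // ->.
  by rewrite subrr.
rewrite -measureU; [|exact: mI|exact: measurable_itv|].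
- apply: le_measure; rewrite ?inE.
  + by apply: measurableU; [exact: mI|exact: measurable_itv].
  + exact: mI.
  + move=> t [[Ut]|] /=; rewrite !in_itv/= => /andP[t1 t2]; split=> //.
    * by rewrite t1/= (lt_le_trans t2)// (le_trans p12).
    * by apply: pU; rewrite /= in_itv/= t1.
    * by rewrite (le_lt_trans (chain_le ch) t1) (lt_le_trans t2).
- apply/seteqP; split=> // t [[_]] /=; rewrite !in_itv/= => /andP[_ t1] /andP[t2 _].
  by move: (lt_trans t1 t2); rewrite ltxx.
Qed.

Lemma chain_abs_cont (V : normedModType R) (g : R -> V) (a b eps : R) :
  absolutely_continuous_on a b g -> 0 < eps ->
  exists2 delta : R, 0 < delta & forall U l, chain U a b l ->
    \sum_(p <- l) (p.2 - p.1) < delta ->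
    \sum_(p <- l) `|g p.2 - g p.1| < eps.
Proof.
move=> ac /ac[delta d0 dP]; exists delta => // U l ch.
rewrite !(big_nth (0, 0)) !big_mkord => ld.
apply: (dP _ (fun i : 'I_(size l) => (nth (0, 0) l i).1)
             (fun i : 'I_(size l) => (nth (0, 0) l i).2)) => //.
- by move=> i; have [] := chain_nth ch (ltn_ord i).
- apply/trivIsetP => i j _ _ ij.
  wlog lt : i j ij / (i < j)%N.
    move=> W; have := ij; rewrite neq_ltn => /orP[|]; first exact: W.
    by rewrite setIC; apply: W; rewrite eq_sym.
  apply/seteqP; split=> // t [] /=; rewrite !in_itv/= => /andP[t1 _] /andP[_ t2].
  have := chain_nth_le (i := i) (j := j) ch; rewrite lt ltn_ord => /(_ isT).
  by move=> /(lt_le_trans t2)/(lt_trans t1); rewrite ltxx.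
Qed.

Lemma null_open_cover (N : set R) (eps : R) : mu.-negligible N -> 0 < eps ->
  exists U, [/\ open U, N `<=` U & (mu U < eps%:E)%E].
Proof.
move=> [A [mA A0 NA]] e0.
have [|U [oU AU Ue]] := lebesgue_regularity_outer mA _ e0.
  rewrite (_ : _ A = 0%E) ?add0e//; exact: A0.
exists U; split=> //; first exact: subset_trans AU.
rewrite -(setDUK AU) measureU//; last 2 first.
- by apply: measurableD => //; exact: open_measurable.
- by apply/seteqP; split=> // t [? []].
rewrite [X in (X + _)%E](_ : _ = 0%E) ?add0e//; exact: A0.
Qed.

Lemma is_derive_first_order (g : R -> R) (c d e : R) :
  is_derive c 1 g d -> 0 < e -> exists2 r : R, 0 < r &
  forall h, `|h| < r -> `|g (c + h) - g c - d * h| <= e * `|h|.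
Proof.
move=> [dg dE] e0; move: dg; rewrite /derivable => /cvg_ex[/= l lP].
have {dE} ld : l = d by rewrite -dE; apply/esym/cvg_lim.
rewrite ld in lP.
move/cvgrPdist_le : lP => /(_ e e0) /nbhs_ballP[r /= r0 rP].
exists r => // h hr; have [->|h0] := eqVneq h 0.
  by rewrite addr0 subrr mulr0 subr0 normr0 mulr0.
have := rP h; rewrite /ball/= sub0r normrN => /(_ hr h0).
rewrite -(ler_pM2l (_ : 0 < `|h|)) ?normr_gt0// -normrM [`|h| * e]mulrC.
rewrite mulrBr [_ *: _](_ : _ = h^-1 * (g (c + h) - g c)); last first.
  by rewrite /= [h *: _]mulr1 [h + c]addrC.
by rewrite mulVKf// distrC [h * d]mulrC.
Qed.

(** The step across a point where the derivative is at most [k] costs at most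
[(k + e)] times its length, by differentiability. The remaining points lie in an
open set [U] of tiny measure, and the steps across them are recorded in a chain
of intervals of [U]; absolute continuity makes the total increment over that chain
at most [e]. *)
Lemma ae_derivative_growth (g : R -> R) (a b k : R) : a <= b ->
  absolutely_continuous_on a b g ->
  {ae mu, forall t, a < t < b -> exists2 d, is_derive t 1 g d & d <= k} ->
  g b - g a <= k * (b - a).
Proof.
move=> ab gac gk.
(* Both endpoints join the exceptional set, since nothing is known there. *)
pose N := ~` [set t | a < t < b -> exists2 d, is_derive t 1 g d & d <= k] `|` [set a] `|` [set b].
have N0 : mu.-negligible N.
  apply: negligibleU; first apply: negligibleU => //.
  - apply/negligibleP => //; exact: lebesgue_measure_set1.
  - apply/negligibleP => //; exact: lebesgue_measure_set1.
apply/ler_addgt0Pr => e' e'0.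
have [e e0 eP] : exists2 e : R, 0 < e & e * (b - a) + e + e = e'.
  have c0 : 0 < b - a + 2 by rewrite ltr_wpDl// subr_ge0.
  exists (e' / (b - a + 2)); first by rewrite divr_gt0.
  by field; rewrite gt_eqF.
have [delta d0 dP] := chain_abs_cont gac e0.
have k0 : 0 < `|k| + 1 by rewrite ltr_wpDl.
have m0 : 0 < Num.min delta (e / (`|k| + 1)) by rewrite lt_min d0 divr_gt0.
have [U [oU NU Ud]] := null_open_cover N0 m0.
(* The last term absorbs [k * (x - a)] over the chain when [k] is negative. *)
pose P x := exists2 l, chain U a x l &
  g x - g a <= (k + e) * (x - a) + \sum_(p <- l) `|g p.2 - g p.1| +
               `|k| * \sum_(p <- l) (p.2 - p.1).
have [l ch lP] : P b.
  apply: (real_induction ab).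
    by exists [::] => //=; rewrite !big_nil !subrr !mulr0 !addr0.
  move=> c /andP[ac cb].
  have [Uc|Uc] := pselect (U c).
    have [r /= r0 rU] : exists2 r : R, 0 < r & ball c r `<=` U.
      by move: oU => /(_ c Uc)/nbhs_ballP[r /= r0 rU]; exists r.
    exists r => // s s' as_ sc cs' s'b crs s'cr [l ch lP].
    exists ((s, s') :: l); last first.
      rewrite !big_cons/=.
      have h1 : 0 <= (s' - s) * (k + `|k| + e).
        rewrite mulr_ge0 ?subr_ge0 ?(le_trans sc)// addr_ge0 ?(ltW e0)//.
        by have := ler_norm (- k); rewrite normrN; lra.
      have := ler_norm (g s' - g s); lra.
    split=> //=; first exact: le_trans cs'.
    move=> t /=; rewrite in_itv/= => /andP[t1 t2]; apply: rU.
    rewrite /ball/= ltr_distlC; apply/andP; split; first exact: lt_trans t1.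
    exact: lt_trans s'cr.
  have [d gd dk] : exists2 d, is_derive c 1 g d & d <= k.
    have : ~ N c by move=> /NU.
    move=> /not_orP[/not_orP[/contrapT H /= ca] cb'].
    apply: H; rewrite !lt_neqAle ac cb !andbT; apply/andP; split; apply/eqP => //.
    by move=> h; apply: ca.
  have [r r0 rP] : exists2 r : R, 0 < r & forall h, `|h| < r -> `|g (c + h) - g c - d * h| <= e * `|h|.
    exact: is_derive_first_order.
  exists r => // s s' as_ sc cs' s'b crs s'cr [l ch lP].
  exists l; first by apply: chain_mono ch; exact: le_trans cs'.
  have := rP (s' - c); have := rP (s - c).
  rewrite ![c + (_ - c)]addrC !subrK.
  rewrite ler0_norm ?subr_le0// (ger0_norm (_ : 0 <= s' - c)) ?subr_ge0//.
  move=> h1 h2.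
  have {h1} := h1 ltac:(lra); have {h2} := h2 ltac:(lra).
  rewrite !ler_norml => /andP[_ h1] /andP[h2 _].
  have h3 : 0 <= (k - d) * (s' - s) by apply: mulr_ge0; lra.
  lra.
have : \sum_(p <- l) (p.2 - p.1) < Num.min delta (e / (`|k| + 1)).
  rewrite -lte_fin; apply: le_lt_trans (chain_measure oU ch) _.
  apply: le_lt_trans Ud; apply: le_measure; rewrite ?inE.
  - by apply: measurableI; [exact: open_measurable|exact: measurable_itv].
  - exact: open_measurable.
  - by move=> t [].
rewrite lt_min => /andP[/(dP U l ch) h1]; rewrite ltr_pdivlMr// => h2.
have h3 : 0 <= \sum_(p <- l) (p.2 - p.1).
  rewrite (big_nth (0, 0)) big_mkord sumr_ge0// => i _.
  by have [_ ? _] := chain_nth ch (ltn_ord i); rewrite subr_ge0.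
have h4 : 0 <= `|k| by [].
lra.
Qed.

End Growth.

(** * Settling of a decaying scalar function *)

Section ScalarSettling.
Context {R : realType}.
Local Notation mu := (@lebesgue_measure R).

Lemma ae_sub (P Q : R -> Prop) : (forall x, P x -> Q x) ->
  {ae mu, forall x, P x} -> {ae mu, forall x, Q x}.
Proof. by move=> PQ; apply: negligibleS => x nQ Px; apply: nQ; exact: PQ. Qed.

Lemma abs_cont_lipschitz (V W : normedModType R) (z : R -> V) (g : R -> W)
    (a b a' b' K : R) : a <= a' -> b' <= b -> 0 <= K ->
  absolutely_continuous_on a b z ->
  (forall s t : R, a' <= s -> s <= t -> t <= b' -> `|g t - g s| <= K * `|z t - z s|) ->
  absolutely_continuous_on a' b' g.
Proof.
move=> aa bb K0 zac gz e e0.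
have K1 : 0 < K + 1 by rewrite ltr_wpDl.
have [d d0 dP] := zac _ (divr_gt0 e0 K1).
exists d => // n s t st tr sd.
have st' i : a <= s i /\ s i <= t i /\ t i <= b.
  by have [h1 [h2 h3]] := st i; rewrite (le_trans aa h1) h2 (le_trans h3 bb).
have := dP n s t st' tr sd; rewrite ltr_pdivlMr//; apply: le_lt_trans.
rewrite mulrC mulr_sumr; apply: ler_sum => i _.
have [h1 [h2 h3]] := st i.
apply: le_trans (gz _ _ h1 h2 h3) _.
by rewrite ler_wpM2r// lerDl.
Qed.

(** A primitive of [1 / (beta v^p + b v)] on the positive reals; it vanishes at 0 when
[p < 1] and at infinity when [p > 1]. *)
Definition decay_clock (beta b p v : R) : R :=
  (b * (1 - p))^-1 * ln (1 + b / beta * v `^ (1 - p)).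

Lemma is_derive_decay_clock (beta b p v : R) : 0 < beta -> 0 < b -> p != 1 ->
  0 < v -> is_derive v 1 (decay_clock beta b p) (beta * v `^ p + b * v)^-1.
Proof.
move=> beta0 b0 p1 v0.
have P0 := powR_gt0 p v0.
have pos : 0 < 1 + b / beta * v `^ (1 - p).
  by rewrite addr_gt0// mulr_gt0 ?divr_gt0// powR_gt0.
have d1 : is_derive v 1 (fun w : R => 1 + b / beta * w `^ (1 - p))
    (b / beta * ((1 - p) * v `^ (1 - p - 1))).
  have := is_deriveD (is_derive_cst (1 : R) v 1) (is_deriveZ (b / beta) (is_derive1_powR (1 - p) v0)).
  by rewrite add0r.
have d2 := @is_derive1_comp R (@ln R) _ v _ _ (is_derive1_ln pos) d1.
have d3 : is_derive v 1 (decay_clock beta b p) _ := is_deriveZ (b * (1 - p))^-1 d2.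
apply: (is_derive_eq d3); rewrite /GRing.scale/= {d2 d3}.
have vE : v `^ (1 - p) = v / v `^ p.
  by rewrite powRB ?powRr1 ?(ltW v0)// (gt_eqF v0) implybT.
have vE' : v `^ (1 - p - 1) = (v `^ p)^-1.
  by rewrite addrAC subrr add0r powRN.
have n1 : beta * v `^ p + b * v != 0.
  by rewrite gt_eqF// addr_gt0// mulr_gt0.
have n2 : beta * v `^ p != 0 by rewrite gt_eqF// mulr_gt0.
have -> : (1 + b / beta * v `^ (1 - p))^-1 = (beta * v `^ p) / (beta * v `^ p + b * v).
  by rewrite vE; field; rewrite n1 !gt_eqF.
have np : 1 - p != 0 by rewrite subr_eq0 eq_sym.
rewrite vE'; field.
by rewrite n1 np !gt_eqF.
Qed.

(** The mean value theorem for a function whose derivative is positive and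
nonincreasing. *)
Lemma decreasing_slope_bounds (h psi : R -> R) (u v : R) :
  (forall w : R, 0 < w -> is_derive w 1 h (psi w)^-1) ->
  (forall w : R, 0 < w -> 0 < psi w) ->
  (forall w w' : R, 0 < w -> w <= w' -> psi w <= psi w') ->
  0 < u -> u <= v -> 0 <= h v - h u <= (psi u)^-1 * (v - u).
Proof.
move=> dh psi0 psile u0; rewrite le_eqVlt => /predU1P[<-|uv].
  by rewrite !subrr mulr0 lexx.
have [||c] := @MVT R h (fun w => (psi w)^-1) u v uv.
- by move=> x; rewrite in_itv/= => /andP[ux _]; apply: dh; exact: lt_trans ux.
- apply: derivable_within_continuous => x; rewrite in_itv/= => /andP[ux _].
  by have [] := dh x (lt_le_trans u0 ux).
rewrite in_itv/= => /andP[uc _] ->.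
have c0 : 0 < c := lt_trans u0 uc.
rewrite mulr_ge0 ?invr_ge0 ?subr_ge0 ?(ltW uv) ?(ltW (psi0 _ c0))//=.
rewrite ler_wpM2r ?subr_ge0 ?(ltW uv)// lef_pV2 ?posrE ?psi0//.
by apply: psile => //; exact: ltW.
Qed.

(** A solution of [phi' <= - psi phi] moves its clock [h], a primitive of [1 / psi],
backwards at unit speed at least. Away from 0 the clock is Lipschitz, so that
[h o phi] is again absolutely continuous and the growth lemma applies. *)
Lemma travel_time (phi h psi : R -> R) (s t m : R) : s <= t -> 0 < m ->
  absolutely_continuous_on s t phi ->
  (forall x : R, s <= x -> x <= t -> m <= phi x) ->
  (forall w : R, 0 < w -> is_derive w 1 h (psi w)^-1) ->
  (forall w : R, 0 < w -> 0 < psi w) ->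
  (forall w w' : R, 0 < w -> w <= w' -> psi w <= psi w') ->
  {ae mu, forall x, s < x < t -> exists2 d, is_derive x 1 phi d & d <= - psi (phi x)} ->
  t - s <= h (phi s) - h (phi t).
Proof.
move=> st m0 ac mphi dh psi0 psile ae.
have hac : absolutely_continuous_on s t (h \o phi).
  apply: (abs_cont_lipschitz (K := (psi m)^-1) _ _ _ ac) => //.
    by rewrite invr_ge0 ltW// psi0.
  suff lip u v : m <= u -> u <= v -> `|h v - h u| <= (psi m)^-1 * `|v - u|.
    move=> x y sx xy yt /=.
    have hx : m <= phi x by apply: mphi => //; exact: le_trans yt.
    have hy : m <= phi y by apply: mphi => //; exact: le_trans xy.
    have [le|/ltW le] := leP (phi x) (phi y); first exact: lip.
    by rewrite distrC [X in _ * X]distrC; exact: lip.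
  move=> mu_ uv; have u0 : 0 < u := lt_le_trans m0 mu_.
  have /andP[h0 h1] := decreasing_slope_bounds dh psi0 psile u0 uv.
  rewrite (ger0_norm h0) (ger0_norm (_ : 0 <= v - u)) ?subr_ge0//.
  apply: le_trans h1 _; rewrite ler_wpM2r ?subr_ge0// lef_pV2 ?posrE ?psi0//.
  exact: psile.
have := ae_derivative_growth (k := -1) st hac _.
rewrite /= mulN1r opprB => W.
suff : h (phi t) - h (phi s) <= s - t by lra.
apply: W; apply: ae_sub ae => x dx sxt.
have [d dphi dle] := dx sxt.
have x0 : 0 < phi x.
  by apply: lt_le_trans m0 _; move: sxt => /andP[? ?]; apply: mphi; exact: ltW.
exists ((psi (phi x))^-1 * d); first exact: (@is_derive1_comp R h phi x _ _ (dh _ x0) dphi).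
by rewrite mulrC ler_pdivrMr ?psi0// mulN1r.
Qed.

Section DecayingScalar.
Variables (phi : R -> R) (beta1 beta2 b p1 p2 : R).
Hypotheses (hbeta1 : 0 < beta1) (hbeta2 : 0 < beta2) (hb : 0 < b).
Hypotheses (hp1 : 0 < p1 < 1) (hp2 : 1 < p2).
Hypothesis phi_ge0 : forall t, 0 <= phi t.
Hypothesis phi_ac : forall B : R, 0 <= B -> absolutely_continuous_on 0 B phi.
Hypothesis phi_decay : {ae mu, forall t : R, 0 < t -> exists2 d, is_derive t 1 phi d &
  d <= - (beta1 * phi t `^ p1 + beta2 * phi t `^ p2 + b * phi t)}.

Lemma decay_nonincreasing (s t : R) : 0 <= s -> s <= t -> phi t <= phi s.
Proof.
move=> s0 st; rewrite -subr_le0.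
have -> : 0 = 0 * (t - s) by rewrite mul0r.
apply: ae_derivative_growth => //.
  apply: (abs_cont_lipschitz (K := 1) s0 (lexx t) _ (phi_ac (le_trans s0 st))) => // x y _ _ _.
  by rewrite mul1r.
apply: ae_sub phi_decay => x dx /andP[sx _].
have [d dphi dle] := dx (le_lt_trans s0 sx).
exists d => //; apply: le_trans dle _.
by rewrite oppr_le0 !addr_ge0// mulr_ge0 ?powR_ge0// ltW.
Qed.

Let rate_mono (beta p w w' : R) : 0 < beta -> 0 < p -> 0 < w -> w <= w' ->
  beta * w `^ p + b * w <= beta * w' `^ p + b * w'.
Proof.
move=> beta0 p0 w0 ww'; apply: lerD; rewrite ler_pM2l//.
by apply: ge0_ler_powR; rewrite ?nnegrE// ltW// (lt_le_trans w0).
Qed.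

(** Above the level [theta] the superlinear power alone drives the decay, and the
clock of exponent [p2] is bounded above by 0, so that this phase cannot last
longer than [- decay_clock beta2 b p2 theta], whatever the initial value is. Below
[theta] the sublinear power takes over, and the clock of exponent [p1] is bounded
below by 0, which limits this phase to [decay_clock beta1 b p1 theta]. The
argument looks at the instant that precedes [t] by the second duration. *)
Lemma decay_settles (theta t : R) : 0 < theta ->
  decay_clock beta1 b p1 theta - decay_clock beta2 b p2 theta < t -> phi t = 0.
Proof.
move=> theta0 tT; apply/eqP; apply: contraT => phit.
have {}phit : 0 < phi t by rewrite lt0r phit phi_ge0.
have /andP[p10 p11] := hp1.
have p20 : 0 < p2 by apply: lt_trans hp2.
have p1n : p1 != 1 by rewrite lt_eqF.
have p2n : p2 != 1 by rewrite gt_eqF.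
have H1pos (v : R) : 0 < v -> 0 < decay_clock beta1 b p1 v.
  move=> v0; rewrite /decay_clock mulr_gt0 ?invr_gt0 ?mulr_gt0 ?subr_gt0//.
  by rewrite ln_gt0// ltrDl mulr_gt0 ?divr_gt0 ?powR_gt0.
have H2neg (v : R) : 0 < v -> decay_clock beta2 b p2 v < 0.
  move=> v0; rewrite /decay_clock nmulr_rlt0.
    by rewrite ln_gt0// ltrDl mulr_gt0 ?divr_gt0 ?powR_gt0.
  by rewrite invr_lt0 pmulr_rlt0// subr_lt0.
have rate_pos (beta p w : R) : 0 < beta -> 0 < w -> 0 < beta * w `^ p + b * w.
  by move=> ? ?; rewrite addr_gt0// mulr_gt0 ?powR_gt0.
have d1 (v : R) (v0 : 0 < v) := is_derive_decay_clock hbeta1 hb p1n v0.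
have d2 (v : R) (v0 : 0 < v) := is_derive_decay_clock hbeta2 hb p2n v0.
have m1 := fun u v => decreasing_slope_bounds (u := u) (v := v) d1 (fun w : R => rate_pos _ p1 w hbeta1) (fun w w' => @rate_mono _ _ w w' hbeta1 p10).
have m2 := fun u v => decreasing_slope_bounds (u := u) (v := v) d2 (fun w : R => rate_pos _ p2 w hbeta2) (fun w w' => @rate_mono _ _ w w' hbeta2 p20).
set T1 := decay_clock beta1 b p1 theta in tT.
set T2 := decay_clock beta2 b p2 theta in tT.
have T10 : 0 < T1 by exact: H1pos.
have T20 : T2 < 0 by exact: H2neg.
pose s := t - T1.
have s0 : 0 < s by rewrite /s; lra.
have st : s <= t by rewrite /s; lra.
have t0 : 0 <= t := le_trans (ltW s0) st.
have ge_phit (x : R) : 0 <= x -> x <= t -> phi t <= phi x by move=> *; exact: decay_nonincreasing.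
have sub_ac (u v : R) : 0 <= u -> u <= v -> v <= t -> absolutely_continuous_on u v phi.
  move=> u0 uv vt.
  apply: (abs_cont_lipschitz (K := 1) u0 vt _ (phi_ac t0)) => // x y _ _ _.
  by rewrite mul1r.
have phis : phi s < theta.
  rewrite ltNge; apply/negP => theta_s.
  have : s - 0 <= decay_clock beta2 b p2 (phi 0) - decay_clock beta2 b p2 (phi s).
    apply: (travel_time (ltW s0) phit) d2 _ _ _ => //.
    - exact: sub_ac (ltW s0) st.
    - by move=> x x0 xs; apply: ge_phit => //; exact: le_trans st.
    - by move=> w; exact: rate_pos.
    - by move=> w w'; exact: rate_mono.
    - apply: ae_sub phi_decay => x dx /andP[x0 _].
      have [d dphi dle] := dx x0; exists d => //; apply: le_trans dle _.
      by rewrite lerN2 -addrA lerDr mulr_ge0 ?powR_ge0// ltW.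
  have := H2neg _ (lt_le_trans theta0 (le_trans theta_s (decay_nonincreasing (lexx 0) (ltW s0)))).
  have /andP[+ _] := m2 _ _ theta0 theta_s.
  by rewrite -/T2 /s; lra.
have : t - s <= decay_clock beta1 b p1 (phi s) - decay_clock beta1 b p1 (phi t).
  apply: (travel_time st phit) d1 _ _ _ => //.
  - exact: sub_ac (ltW s0) st (lexx _).
  - by move=> x x0 xs; apply: ge_phit => //; exact: le_trans (ltW s0) x0.
  - by move=> w; exact: rate_pos.
  - by move=> w w'; exact: rate_mono.
  - apply: ae_sub phi_decay => x dx /andP[x0 _].
    have [d dphi dle] := dx (lt_trans s0 x0); exists d => //; apply: le_trans dle _.
    by rewrite lerN2 addrAC lerDl mulr_ge0 ?powR_ge0// ltW.
have := H1pos _ phit.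
have /andP[+ _] := m1 _ _ (lt_le_trans phit (ge_phit _ (ltW s0) st)) (ltW phis).
by rewrite -/T1 /s; lra.
Qed.

End DecayingScalar.
End ScalarSettling.

(** * The derivative of the norm along a curve *)

Section NormDerivative.
Context {R : realType} {V : normedModType R} (dot : {dot V for idfun}).
Hypothesis hdot : norm_from_dot dot.

Lemma is_derive_cvgP (W : normedModType R) (f : R -> W) (t : R) (df : W) :
  is_derive t 1 f df <-> h^-1 *: (f (h + t) - f t) @[h --> (0 : R)^'] --> df.
Proof.
have E : (fun h : R => h^-1 *: (f (h + t) - f t)) =
    (fun h : R => h^-1 *: ((f \o shift t) (h *: 1) - f t)).
  by apply/funext => h /=; rewrite [h *: 1]mulr1.
rewrite E; split.
  by move=> [df1 <-]; exact: df1.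
move=> h; apply: DeriveDef; first exact: cvgP h.
exact: cvg_lim.
Qed.

Lemma dot_cvg (F : set_system R) (FF : Filter F) (u : R -> V) l y :
  u @ F --> l -> dot (u h) y @[h --> F] --> dot l y.
Proof.
move=> ul; apply/cvgrPdist_lt => e e0.
have yp : 0 < `|y| + 1 by rewrite ltr_wpDl.
move/cvgrPdist_lt : ul => /(_ (e / (`|y| + 1)) (divr_gt0 e0 yp)).
apply: filterS => n; rewrite ltr_pdivlMr// => h.
rewrite -dotNl -dotDl; apply: le_lt_trans (cauchy_schwarz hdot _ _) _.
by apply: le_lt_trans h; rewrite ler_wpM2l// lerDl.
Qed.

Lemma is_derive_dot_self (y : R -> V) (t : R) (v : V) : is_derive t 1 y v ->
  is_derive t 1 (fun s => dot (y s) (y s)) (2 * dot v (y t)).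
Proof.
move=> /is_derive_cvgP yv; apply/is_derive_cvgP.
(* [|y(t+h)|^2 - |y(t)|^2 = 2 <y(t+h) - y(t), y(t)> + |y(t+h) - y(t)|^2]. *)
pose D h := h^-1 *: (y (h + t) - y t).
have lim : 2 * dot (D h) (y t) + h * (`|D h| * `|D h|) @[h --> (0 : R)^'] -->
    2 * dot v (y t) + 0 * (`|v| * `|v|).
  apply: cvgD.
    by apply: cvgM; [exact: cvg_cst|exact: dot_cvg].
  apply: cvgM; first exact: cvg_within.
  by apply: cvgM; exact: cvg_norm.
rewrite mul0r addr0 in lim.
apply: cvg_trans lim; apply: near_eq_cvg.
near=> h.
have h0 : h != 0 by near: h; exact: nbhs_dnbhs_neq.
have yE : y (h + t) = h *: D h + y t by rewrite /D scalerA mulfV// scale1r subrK.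
rewrite -expr2 (norm_sqr hdot) yE /GRing.scale/=.
move: (D h) (y t) => w yt; rewrite !dotE (dotC dot yt w); field; exact: h0.
Unshelve. all: by end_near. Qed.

Lemma is_derive_norm (y : R -> V) (t : R) (v : V) : y t != 0 ->
  is_derive t 1 y v ->
  is_derive t 1 (fun s => `|y s|) (dot (y t) v / `|y t|).
Proof.
move=> y0 yv.
have -> : (fun s => `|y s|) = Num.sqrt \o (fun s => dot (y s) (y s)).
  by apply/funext => s; rewrite /= hdot.
have q0 : 0 < dot (y t) (y t) by exact: neq0_dnorm_gt0.
apply: (is_derive_eq (@is_derive1_comp R Num.sqrt _ t _ _ (is_derive1_sqrt q0) (is_derive_dot_self yv))).
rewrite -hdot (dotC dot v); field.
by rewrite normr_eq0.
Qed.

(** The norm is not differentiable at 0, but a curve that crosses 0 with zero velocity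
has a differentiable norm. *)
Lemma is_derive_norm0 (y : R -> V) (t : R) : y t = 0 ->
  is_derive t 1 y 0 -> is_derive t 1 (fun s => `|y s|) 0.
Proof.
move=> y0 /is_derive_cvgP yv; apply/is_derive_cvgP; apply/norm_cvg0P.
move/norm_cvg0P : yv.
suff -> : (fun h : R => `|h^-1 *: (`|y (h + t)| - `|y t|)|) =
  (fun h : R => `|h^-1 *: (y (h + t) - y t)|) by [].
by apply/funext => h; rewrite y0 normr0 !subr0 normrZ normr_id -normrZ.
Qed.

End NormDerivative.

(** * Trajectories of the forward-backward system *)

Section Residual.
Context {R : realType} {V : normedModType R} (dot : {dot V for idfun}).
Hypothesis hdot : norm_from_dot dot.
Variables (gamma : R) (F : V -> set V) (G : V -> V) (c : R) (zs : V).
Hypothesis hB : c.-lipschitz (fb_operator gamma F G).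
Hypothesis hzs : fb_residual gamma F G zs = 0.
Local Notation Phi := (fb_residual gamma F G).
Local Notation B := (fb_operator gamma F G).

Let BE z : `|B z - B zs| <= c * `|z - zs|.
Proof. exact: (hB (x := (z, zs))). Qed.

Let PhiE z : Phi z = (z - zs) - (B z - B zs).
Proof.
have /eqP := hzs; rewrite subr_eq0 => /eqP <-.
by rewrite /fb_residual opprB addrA subrK.
Qed.

Lemma residual_le z : `|Phi z| <= (1 + c) * `|z - zs|.
Proof.
rewrite PhiE mulrDl mul1r; apply: le_trans (ler_normB _ _) _.
by rewrite lerD2l.
Qed.

Lemma residual_ge z : (1 - c) * `|z - zs| <= `|Phi z|.
Proof.
rewrite PhiE mulrBl mul1r; apply: le_trans (lerB_dist _ _).
by rewrite lerD2l lerN2.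
Qed.

(** The residual is the identity minus a [c]-contraction. *)
Lemma residual_strongly_monotone z :
  (1 - c) * `|z - zs| ^+ 2 <= dot (z - zs) (Phi z).
Proof.
rewrite PhiE dotDr dotNr -(norm_sqr hdot) mulrBl mul1r lerD2l lerN2.
apply: le_trans (dot_le hdot _ _) _.
by rewrite expr2 mulrCA ler_wpM2l.
Qed.

End Residual.

Section Trajectories.
Context {R : realType} {V : normedModType R} (dot : {dot V for idfun}).
Hypothesis hdot : norm_from_dot dot.
Variables (gamma : R) (F : V -> set V) (G : V -> V) (c : R) (zs : V).
Hypotheses (hc : 0 < c < 1) (hB : c.-lipschitz (fb_operator gamma F G)).
Variables (b1 b2 b3 p1 p2 p3 Kp Tp : R).
Hypotheses (hb1 : 0 < b1) (hb2 : 0 < b2) (hb3 : 0 < b3).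
Hypotheses (hKp : 0 < Kp) (hTp : 0 < Tp) (hp1 : 0 < p1 < 1) (hp2 : 1 < p2).
Local Notation Phi := (fb_residual gamma F G).
Local Notation f := (vector_field gamma F G b1 b2 b3 p1 p2 p3 Kp Tp).
Local Notation mu := (@lebesgue_measure R).

Lemma weight_gt0 (w : V) : w != 0 -> 0 < weight b1 b2 b3 p1 p2 p3 w.
Proof.
move=> w0; rewrite /weight (negbTE w0).
by rewrite !addr_gt0// mulr_gt0// powR_gt0// normr_gt0.
Qed.

Lemma equilibrium_residual z : equilibrium f z -> Phi z = 0.
Proof.
move=> /eqP; rewrite /vector_field scaler_eq0 => /orP[|/eqP//].
apply: contraTeq => /weight_gt0 w0.
by rewrite oppr_eq0 gt_eqF// mulr_gt0// divr_gt0.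
Qed.

Hypothesis hzs : Phi zs = 0.

(** The coefficients of the powers [p1] and [p2] of the distance in its decay rate. *)
Definition rate1 := Kp / Tp * (1 - c) * (b1 * (1 + c) `^ (- (1 - p1))).
Definition rate2 := Kp / Tp * (1 - c) * (b2 * (1 - c) `^ (- (1 - p2))).

(** Along a trajectory the derivative of [|z - zs|] is
[- (Kp / Tp) omega <z - zs, Phi> / |z - zs|], at most
[- (Kp / Tp) (1 - c) omega |z - zs|] by strong monotonicity. In [omega] the residual
is compared with the distance: from above in the negative power [p1 - 1], whence
the factor [1 + c], and from below in the positive power [p2 - 1], whence [1 - c].
The constant [b] stands for any lower bound of the third term of [omega]: it is
[b3] when [p3 = 0] and 0 otherwise. The estimate persists where the trajectory
sits at [zs], because the velocity vanishes there. *)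
Lemma distance_decay (z : R -> V) (b : R) : solution f z ->
  (forall w, 0 < w -> b <= b3 * w `^ (- p3)) ->
  {ae mu, forall t : R, 0 < t -> exists2 d, is_derive t 1 (fun s => `|z s - zs|) d &
    d <= - (rate1 * `|z t - zs| `^ p1 + rate2 * `|z t - zs| `^ p2
            + Kp / Tp * (1 - c) * b * `|z t - zs|)}.
Proof.
move=> [_ zf] hb; apply: ae_sub zf => t dz t0.
have {}dz := dz t0.
have /andP[c0 c1] := hc; have /andP[p10 p11] := hp1.
have dy : is_derive t 1 (fun s => z s - zs) (f (z t)).
  have := is_deriveB dz (is_derive_cst zs t 1).
  by rewrite subr0.
have [y0|y0] := eqVneq (z t - zs) 0.
  exists 0.
    apply: (is_derive_norm0 (y := fun s => z s - zs)) => //.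
    have ztE : z t = zs by apply/eqP; rewrite -subr_eq0 y0.
    by move: dy; rewrite ztE /vector_field hzs scaler0.
  rewrite y0 normr0 !powR0 ?mulr0 ?addr0 ?oppr0//.
    by rewrite gt_eqF// (lt_trans _ hp2).
  by rewrite gt_eqF.
exists (dot (z t - zs) (f (z t)) / `|z t - zs|).
  exact: (is_derive_norm hdot (y := fun s => z s - zs)).
have k0 : 0 < Kp / Tp by rewrite divr_gt0.
have D0 : 0 < `|z t - zs| by rewrite normr_gt0.
have Ple := residual_le hB hzs (z t).
have Pge := residual_ge hB hzs (z t).
have Pmon := residual_strongly_monotone hdot hB hzs (z t).
have P0 : 0 < `|Phi (z t)| by apply: lt_le_trans Pge; rewrite mulr_gt0// subr_gt0.
rewrite ler_pdivrMr// /vector_field dotZr.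
have W0 : 0 < weight b1 b2 b3 p1 p2 p3 (Phi (z t)) by rewrite weight_gt0// -normr_gt0.
rewrite !mulNr lerN2.
apply: le_trans (ler_wpM2l (ltW (mulr_gt0 k0 W0)) Pmon).
set D := `|z t - zs| in D0 Ple Pge *.
rewrite /weight -normr_eq0 gt_eqF//.
set P := `|Phi (z t)| in P0 Ple Pge *.
have q1 : (1 + c) `^ (- (1 - p1)) * D `^ p1 <= P `^ (- (1 - p1)) * D.
  have -> : D `^ p1 = D `^ (- (1 - p1)) * D.
    rewrite -[X in _ * X](powRr1 (ltW D0)) -powRD ?(gt_eqF D0) ?implybT//.
    by congr (_ `^ _); ring.
  rewrite mulrA -powRM ?(ltW D0)//; last lra.
  rewrite ler_wpM2r ?(ltW D0)// !powRN lef_pV2 ?posrE ?powR_gt0//.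
    by apply: ge0_ler_powR; rewrite ?nnegrE ?(ltW P0)// ?subr_ge0 ?(ltW p11)// mulr_ge0// ?(ltW D0)//; lra.
  by rewrite mulr_gt0//; lra.
have q2 : (1 - c) `^ (- (1 - p2)) * D `^ p2 <= P `^ (- (1 - p2)) * D.
  have -> : D `^ p2 = D `^ (- (1 - p2)) * D.
    rewrite -[X in _ * X](powRr1 (ltW D0)) -powRD ?(gt_eqF D0) ?implybT//.
    by congr (_ `^ _); ring.
  rewrite mulrA -powRM ?(ltW D0)//; last lra.
  rewrite ler_wpM2r ?(ltW D0)// opprB.
  apply: ge0_ler_powR; rewrite ?nnegrE ?(ltW P0)// ?subr_ge0 ?(ltW hp2)//.
  by rewrite mulr_ge0// ?(ltW D0)//; lra.
have q3 := hb P P0.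
rewrite /rate1 /rate2.
have -> : (Kp / Tp * (1 - c) * (b1 * (1 + c) `^ (- (1 - p1))) * D `^ p1 +
  Kp / Tp * (1 - c) * (b2 * (1 - c) `^ (- (1 - p2))) * D `^ p2 +
  Kp / Tp * (1 - c) * b * D) * D =
  (Kp / Tp * (1 - c) * D) * (b1 * ((1 + c) `^ (- (1 - p1)) * D `^ p1) +
   b2 * ((1 - c) `^ (- (1 - p2)) * D `^ p2) + b * D) by ring.
have -> : Kp / Tp * (b1 * P `^ (- (1 - p1)) + b2 * P `^ (- (1 - p2)) + b3 * P `^ (- p3)) *
  ((1 - c) * D ^+ 2) = (Kp / Tp * (1 - c) * D) * (b1 * (P `^ (- (1 - p1)) * D) +
   b2 * (P `^ (- (1 - p2)) * D) + b3 * P `^ (- p3) * D) by ring.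
rewrite ler_pM2l; last by rewrite (mulr_gt0 _ D0)// mulr_gt0// subr_gt0.
by rewrite !lerD// ?ler_pM2l// ler_pM2r.
Qed.

Lemma distance_abs_cont (z : R -> V) (b : R) : solution f z -> 0 <= b ->
  absolutely_continuous_on 0 b (fun s => `|z s - zs|).
Proof.
move=> [zac _] b0.
apply: (abs_cont_lipschitz (K := 1) (lexx 0) (lexx b) ler01 (zac b b0)) => s t _ _ _.
rewrite mul1r; apply: le_trans (ler_dist_dist _ _) _.
by rewrite opprB addrA subrK.
Qed.

Lemma rate1_gt0 : 0 < rate1.
Proof.
have /andP[c0 c1] := hc.
by rewrite /rate1 !mulr_gt0 ?invr_gt0 ?powR_gt0 ?subr_gt0// addr_gt0.
Qed.

Lemma rate2_gt0 : 0 < rate2.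
Proof.
have /andP[c0 c1] := hc.
by rewrite /rate2 !mulr_gt0 ?invr_gt0 ?powR_gt0 ?subr_gt0.
Qed.

Lemma settling_time_le (T : R) : 0 <= T ->
  (forall z, solution f z -> forall t, T < t -> z t = zs) ->
  forall z0, (settling_time f zs z0 <= T%:E)%E.
Proof.
move=> T0 HT z0; apply/lee_addgt0Pr => e e0.
apply: ereal_inf_lbound; exists (T + e) => //; split; first by rewrite addr_ge0// ltW.
move=> z sz _ t Tt; apply: (HT z sz); apply: lt_le_trans Tt; by rewrite ltrDl.
Qed.

(** With the threshold [sqrt 2] (half the squared distance equals 1) the two clock
values of the scalar estimate add up to [Tp / Kp] times the prescribed gain. *)
Lemma predefined_time_settling : p3 = 0 ->
  Kp = predefined_gain b1 b2 b3 p1 p2 c ->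
  forall z, solution f z -> forall t, Tp < t -> z t = zs.
Proof.
move=> p30 KE z sz t Tt.
have /andP[c0 c1] := hc; have /andP[p10 p11] := hp1.
have b_le w : 0 < w -> b3 <= b3 * w `^ (- p3).
  by move=> w0; rewrite p30 oppr0 powRr0 mulr1.
have k0 : 0 < Kp / Tp * (1 - c) by rewrite mulr_gt0 ?divr_gt0 ?subr_gt0.
have D := distance_decay sz b_le.
have s2 : (0 : R) < Num.sqrt 2 by rewrite sqrtr_gt0.
have sE q : (Num.sqrt 2 : R) `^ q = 2 `^ (q / 2).
  by rewrite -powR12_sqrt// -powRrM mulrC.
suff : `|z t - zs| = 0 by move/eqP; rewrite normr_eq0 subr_eq0 => /eqP.
apply: (@decay_settles R (fun s => `|z s - zs|) rate1 rate2 _ p1 p2 rate1_gt0 rate2_gt0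
   (mulr_gt0 k0 hb3) hp1 hp2 (fun s => normr_ge0 _) (fun b => distance_abs_cont sz) D _ _ s2).
suff -> : decay_clock rate1 (Kp / Tp * (1 - c) * b3) p1 (Num.sqrt 2) -
   decay_clock rate2 (Kp / Tp * (1 - c) * b3) p2 (Num.sqrt 2) = Tp by [].
have r1 : Kp / Tp * (1 - c) * b3 / rate1 = b3 * (1 + c) `^ (1 - p1) / b1.
  have := powR_gt0 (1 - p1) (_ : 0 < 1 + c).
  rewrite /rate1 powRN => /(_ ltac:(lra)) h; field.
  by rewrite !gt_eqF// subr_gt0.
have r2 : Kp / Tp * (1 - c) * b3 / rate2 = b3 * (1 - c) `^ (1 - p2) / b2.
  have := powR_gt0 (1 - p2) (_ : 0 < 1 - c).
  rewrite /rate2 powRN => /(_ ltac:(lra)) h; field.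
  by rewrite !gt_eqF// subr_gt0.
rewrite /decay_clock r1 r2 !sE.
set L1 := ln _; set L2 := ln _.
have E : Tp / Kp * predefined_gain b1 b2 b3 p1 p2 c = Tp by rewrite -KE divfK ?gt_eqF.
rewrite -[RHS]E /predefined_gain.
have -> : ln (1 + b3 * 2 `^ ((1 - p1) / 2) * (1 + c) `^ (1 - p1) / b1) = L1.
  by rewrite /L1; congr (ln (1 + _)); ring.
have -> : ln (1 + b3 * 2 `^ ((1 - p2) / 2) * (1 - c) `^ (1 - p2) / b2) = L2.
  by rewrite /L2; congr (ln (1 + _)); ring.
field.
have n1 : 1 - p2 != 0 by rewrite subr_eq0 lt_eqF.
have n2 : p2 - 1 != 0 by rewrite subr_eq0 gt_eqF.
by rewrite n1 n2 !gt_eqF// subr_gt0.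
Qed.

Definition linear_rate := Num.min (rate1 / 2) (rate2 / 2).

Lemma linear_rate_gt0 : 0 < linear_rate.
Proof. by rewrite lt_min !divr_gt0 ?rate1_gt0 ?rate2_gt0. Qed.

(** A linear term comes for free, because [x <= max (x^p1) (x^p2)]: half of
the two power terms is traded for it, which brings the system to the form of
the scalar estimate for every value of [p3]. *)
Lemma distance_decay_linear (z : R -> V) : solution f z ->
  {ae mu, forall t : R, 0 < t -> exists2 d, is_derive t 1 (fun s => `|z s - zs|) d &
    d <= - (rate1 / 2 * `|z t - zs| `^ p1 + rate2 / 2 * `|z t - zs| `^ p2
            + linear_rate * `|z t - zs|)}.
Proof.
move=> sz.
have D := distance_decay sz (fun w w0 => mulr_ge0 (ltW hb3) (powR_ge0 w (- p3))).
apply: ae_sub D => s ds s0; have [d dd dle] := ds s0.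
exists d => //; apply: le_trans dle _; rewrite lerN2 mulr0 mul0r addr0.
move: `|z s - zs| (normr_ge0 (z s - zs)) => x x0.
have q1 : 0 <= x `^ p1 by exact: powR_ge0.
have q2 : 0 <= x `^ p2 by exact: powR_ge0.
have h1 : 0 < rate1 / 2 by rewrite divr_gt0 ?rate1_gt0.
have h2 : 0 < rate2 / 2 by rewrite divr_gt0 ?rate2_gt0.
have xle : x <= x `^ p1 \/ x <= x `^ p2.
  have /andP[p10 p11] := hp1.
  have [x1|/ltW x1] := leP x 1; [left|right].
    have [->|xn] := eqVneq x 0; first by rewrite powR_ge0.
    rewrite -[leLHS](powRr1 x0); apply: ger_powR; last exact: ltW.
    by rewrite lt0r xn x0.
  by rewrite -[leLHS](powRr1 x0); apply: ler_powR => //; exact: ltW.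
have bx : linear_rate * x <= rate1 / 2 * x `^ p1 + rate2 / 2 * x `^ p2.
  have b0 := ltW linear_rate_gt0.
  case: xle => xle.
    apply: le_trans (ler_pM b0 x0 (_ : linear_rate <= rate1 / 2) xle) _.
      by rewrite ge_min lexx.
    by rewrite lerDl mulr_ge0// ltW.
  apply: le_trans (ler_pM b0 x0 (_ : linear_rate <= rate2 / 2) xle) _.
    by rewrite ge_min lexx orbT.
  by rewrite lerDr mulr_ge0// ltW.
lra.
Qed.

Lemma uniform_settling : exists2 T : R, 0 < T &
  forall z, solution f z -> forall t, T < t -> z t = zs.
Proof.
have h1 : 0 < rate1 / 2 by rewrite divr_gt0 ?rate1_gt0.
have h2 : 0 < rate2 / 2 by rewrite divr_gt0 ?rate2_gt0.
pose T := decay_clock (rate1 / 2) linear_rate p1 1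
          - decay_clock (rate2 / 2) linear_rate p2 1.
exists (Num.max 1 T); first by rewrite lt_max ltr01.
move=> z sz t; rewrite gt_max => /andP[_ Tt].
suff : `|z t - zs| = 0 by move/eqP; rewrite normr_eq0 subr_eq0 => /eqP.
exact: (@decay_settles R (fun s => `|z s - zs|) (rate1 / 2) (rate2 / 2) linear_rate p1 p2
  h1 h2 linear_rate_gt0 hp1 hp2 (fun s => normr_ge0 _) (fun b => distance_abs_cont sz)
  (distance_decay_linear sz) 1 t ltr01 Tt).
Qed.

Lemma equilibrium_lyapunov_stable : equilibrium f zs -> lyapunov_stable f zs.
Proof.
move=> eq; split=> // e e0; exists e => // z sz z0 t t0.
have h1 : 0 < rate1 / 2 by rewrite divr_gt0 ?rate1_gt0.
have h2 : 0 < rate2 / 2 by rewrite divr_gt0 ?rate2_gt0.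
move: z0; rewrite -!ball_normE /ball_/= ![`|zs - _|]distrC; apply: le_lt_trans.
exact: (@decay_nonincreasing R (fun s => `|z s - zs|) (rate1 / 2) (rate2 / 2) linear_rate p1 p2
  h1 h2 linear_rate_gt0 (fun s => normr_ge0 _) (fun b => distance_abs_cont sz)
  (distance_decay_linear sz) 0 t (lexx 0) (ltW t0)).
Qed.

End Trajectories.

(** * Settling time bounds *)

Lemma fixed_time_bound_equal (R : realType) (M r1 r2 : R) :
  fixed_time_bound M M r1 r2 = ((1 - r1)^-1 + (r2 - 1)^-1) / M.
Proof. by rewrite /fixed_time_bound !div1r !invfM mulrDl [M^-1 * _]mulrC [M^-1 * _]mulrC. Qed.

Lemma refined_bound_equal (R : realType) (M zeta : R) : 0 < M ->
  refined_bound M M zeta = pi * zeta / M.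
Proof. by move=> M0; rewrite /refined_bound -expr2 sqrtr_sqr gtr0_norm. Qed.

Theorem theorem3p5 (R : realType) (V : normedModType R)
    (dot : {dot V for idfun})
    (hdot : norm_from_dot dot) (hdim : @finite_dimensional R V)
    (F : V -> set V) (G : V -> V) (etaF etaG L gamma : R)
    (hF : maximal_eta_monotone dot etaF F)
    (hG : eta_monotone dot etaG (fun z => [set G z]))
    (hL : 0 <= L) (hGL : L.-lipschitz G)
    (hgamma : 0 < gamma) (hgammaF : 0 < 1 + gamma * etaF)
    (hpar : 0 < 2 * (etaF + etaG) + gamma * etaF ^+ 2 - gamma * L ^+ 2)
    (b1 b2 b3 Kp Tp p1 p2 p3 : R)
    (hb1 : 0 < b1) (hb2 : 0 < b2) (hb3 : 0 < b3)
    (hKp : 0 < Kp) (hTp : 0 < Tp)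
    (hp1 : 0 < p1 < 1) (hp2 : 1 < p2) (zs : V) :
  let f := vector_field gamma F G b1 b2 b3 p1 p2 p3 Kp Tp in
  equilibrium f zs -> (forall z, equilibrium f z -> z = zs) ->
  [/\ 0 < p3 ->
        [/\ solves_inclusion F G zs,
            fixed_time_stable f zs &
            exists M1 M2 r1 r2 : R,
              [/\ 0 < M1, 0 < M2, 2^-1 < r1 < 1, 1 < r2 &
                  forall z0 : V, (settling_time f zs z0 <=
                    (fixed_time_bound M1 M2 r1 r2)%:E)%E]],
      0 < p3 -> forall zeta : R, 1 < zeta ->
        exists M1 M2 : R,
          let r1 := 1 - 1 / (2 * zeta) in
          let r2 := 1 + 1 / (2 * zeta) in
          [/\ 0 < M1, 0 < M2,
              forall z0 : V, (settling_time f zs z0 <=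
                (fixed_time_bound M1 M2 r1 r2)%:E)%E &
              forall z0 : V, (settling_time f zs z0 <=
                (refined_bound M1 M2 zeta)%:E)%E] &
      p3 = 0 -> forall c : R, 0 < c < 1 -> c.-lipschitz (fb_operator gamma F G) ->
        Kp = predefined_gain b1 b2 b3 p1 p2 c ->
        forall z0 : V, (settling_time f zs z0 <= Tp%:E)%E].
Proof.
move=> f eqzs _.
have /andP[p10 p11] := hp1.
have hzs : fb_residual gamma F G zs = 0.
  exact: (equilibrium_residual hb1 hb2 hb3 hKp hTp eqzs).
have [c c01 hB] := fb_operator_contraction hdot hdim hF hG hL hGL hgamma hgammaF hpar.
have [T T0 HT] := uniform_settling hdot c01 hB p3 hb1 hb2 hb3 hKp hTp hp1 hp2 hzs.
have settle T' : T <= T' -> forall z0, (settling_time f zs z0 <= T'%:E)%E.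
  move=> TT' z0; apply: le_trans (_ : _ <= T%:E)%E _; last by rewrite lee_fin.
  by apply: settling_time_le => //; exact: ltW.
have settleT z0 := settle T (lexx T) z0.
split.
- move=> p30; split.
  + exact: (fixed_point_solves_inclusion hdot hdim hF hgamma hgammaF hzs).
  + split; last by exists T.
    split; last by move=> z0; apply: le_lt_trans (settleT z0) _; rewrite ltry.
    exact: (equilibrium_lyapunov_stable hdot c01 hB hb1 hb2 hb3 hKp hTp hp1 hp2 hzs).
  + pose r1 := (1 + p1) / 2; pose r2 := (1 + p2) / 2.
    have r10 : 0 < 1 - r1 by rewrite /r1; lra.
    have r20 : 0 < r2 - 1 by rewrite /r2; lra.
    have S0 : 0 < (1 - r1)^-1 + (r2 - 1)^-1 by rewrite addr_gt0 ?invr_gt0.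
    (* This value is chosen so that the bound equals [T]. *)
    pose M := ((1 - r1)^-1 + (r2 - 1)^-1) / T.
    have M0 : 0 < M by rewrite divr_gt0.
    exists M, M, r1, r2; split => //; [by rewrite /r1; apply/andP; split; lra|by rewrite /r2; lra|].
    apply: settle; rewrite fixed_time_bound_equal /M invfM invrK mulVKf//.
    by rewrite gt_eqF.
- move=> p30 zeta zeta1.
  have zeta0 : 0 < zeta by lra.
  (* The refined bound equals [T] for this value, and the other bound is
     [4 * T / pi], which is larger since [pi <= 4]. *)
  pose M := pi * zeta / T.
  have M0 : 0 < M by rewrite !mulr_gt0 ?pi_gt0 ?invr_gt0.
  have piz : pi * zeta != 0 by rewrite mulf_neq0 ?gt_eqF ?pi_gt0.
  exists M, M => r1 r2; split => //; apply: settle.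
    rewrite fixed_time_bound_equal ler_pdivlMr// /M.
    have -> : (1 - r1)^-1 + (r2 - 1)^-1 = 4 * zeta.
      by rewrite /r1 subKr /r2 [1 + _]addrC addrK div1r invrK; ring.
    have -> : T * (pi * zeta / T) = pi * zeta by field; rewrite gt_eqF.
    by rewrite ler_pM2r//; have := @pihalf_lt2 R; lra.
  by rewrite refined_bound_equal// /M invfM invrK mulVKf.
- move=> p30 c' c'01 hB' KE z0.
  apply: settling_time_le; first exact: ltW.
  exact: (predefined_time_settling hdot c'01 hB' hb1 hb2 hb3 hKp hTp hp1 hp2 hzs p30 KE).
Qed.
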